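(* Let $\mathfrak X$ be a homogeneous tree of degree $q+1$ ($q\geq1$). Let $k\geq 0$ be an integer and let $Q=\sum_{i=0}^{k}c_i\mu_i$ be a linear operator on $\mathcal F(\mathfrak X)$, where $c_i\in\mathbb C$ and $c_k\neq 0$. Then $Q:\mathcal F(\mathfrak X)\to\mathcal F(\mathfrak X)$ is surjective.
   Context: $\mathfrak X$ is a tree in which every vertex has exactly $q+1$ edges; $d$ is the graph distance. $\mathcal F(\mathfrak X)$ is the space of complex-valued functions on the vertices. $S_k(v)=\{w:d(v,w)=k\}$. The spherical mean value operator is $\mu_0f=f$ and, for $k\geq1$, $\mu_kf(v)=\frac{1}{(q+1)q^{k-1}}\sum_{w\in S_k(v)}f(w)$. *)

(* Defs.v *)
From HB Require Import structures.
From mathcomp Require Import all_boot all_order all_algebra.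
From mathcomp Require Import boolp classical_sets functions cardinality fsbigop.
From mathcomp Require Import reals complex.

Set Implicit Arguments.
Unset Strict Implicit.
Unset Printing Implicit Defensive.

Import GRing.Theory.

Local Open Scope classical_set_scope.
Local Open Scope card_scope.
Local Open Scope ring_scope.

Section Graph.
Variables (V : choiceType) (adj : rel V).

Definition has_walk (x y : V) (n : nat) : bool :=
  `[< exists p : seq V, [/\ path adj x p, last x p = y & size p = n] >].

Definition graph_connected : Prop := forall x y : V, exists n, has_walk x y n.

(* [ucycle adj s] is closed and without repetition; sizes 1 and 2 would be a
   loop and an edge walked back and forth, hence the bound on the size. *)
Definition graph_acyclic : Prop :=
  forall s : seq V, ucycle adj s -> (size s < 3)%N.

Definition is_tree : Prop :=
  [/\ symmetric adj, irreflexive adj, graph_connected & graph_acyclic].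

Definition homogeneous_tree (q : nat) : Prop :=
  is_tree /\ forall v : V, [set w | adj v w] #= `I_q.+1.

(* The value 0 for vertices that no walk joins is never used in a connected
   graph. *)
Definition gdist (x y : V) : nat :=
  if pselect (exists n, has_walk x y n) is left walk_xy
  then ex_minn walk_xy else 0%N.

Definition sphere (k : nat) (v : V) : set V := [set w | gdist v w = k].

(* The sum ranges over a finite set when every vertex has finite degree. *)
Definition mean_value (R : realType) (q k : nat) (f : V -> R[i]) (v : V) : R[i] :=
  if k is j.+1 then
    ((q.+1 * q ^ j)%N%:R)^-1 * \sum_(w \in sphere k v) f w
  else f v.

Definition mean_value_comb (R : realType) (q k : nat) (c : nat -> R[i])
    (f : V -> R[i]) (v : V) : R[i] :=
  \sum_(i < k.+1) c i * mean_value q i f v.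

End Graph.

(* Main.v *)
Require Import Defs.
From HB Require Import structures.
From mathcomp Require Import all_boot all_order all_algebra.
From mathcomp Require Import boolp classical_sets functions cardinality fsbigop.
From mathcomp Require Import reals complex.
From mathcomp Require Import ring.

Set Implicit Arguments.
Unset Strict Implicit.
Unset Printing Implicit Defensive.

Local Open Scope classical_set_scope.
Local Open Scope ring_scope.

(** Fix a root [o] and let [|v| = d(o, v)].  Every vertex has a neighbour one
    step further from [o], so every [v] has a descendant [s v] with
    [d(v, s v) = k] and [|s v| = |v| + k]; since geodesics are unique, [v] is
    recovered from [s v] as the vertex at depth [|v|] on the geodesic from [o].
    Look for a solution of [Q f = g] supported on the image of [s].  If [s v']
    is at distance at most [k] from [v] then [|v'| <= |v|], with equality only
    if [v' = v]; hence [Q f v = g v] is a triangular system for the unknowns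
    [f (s v)], with diagonal coefficient [c k] times the weight of the sphere
    of radius [k]. *)

(** After [n] iterations of [Phi] the values at depth below [n] no longer change, because each
    application settles one more level. The solution reads the value at [v] after [(depth v).+1]
    iterations, the first stage at which it is settled. *)
Lemma triangular_fixpoint (V T : Type) (depth : V -> nat)
    (Phi : (V -> T) -> V -> T) (f0 : V -> T) :
  (forall f1 f2 v, (forall u, (depth u < depth v)%N -> f1 u = f2 u) ->
     Phi f1 v = Phi f2 v) ->
  exists f, forall v, f v = Phi f v.
Proof.
move=> causal; pose F n := iter n Phi f0.
have stable n : forall m1 m2 v, (depth v < n)%N -> (n <= m1)%N -> (n <= m2)%N ->
    F m1 v = F m2 v.
  elim: n => // n IHn [//|m1] [//|m2] v ltvn le1 le2 /=.
  by apply: causal => u ltuv; apply: IHn => //; apply: leq_trans ltuv _.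
exists (fun v => F (depth v).+1 v) => v /=.
by apply: causal => u ltuv; exact: (stable (depth u).+1 (depth v) (depth u).+1).
Qed.

(** * Distance and geodesics in a connected graph *)

Section Distance.
Variables (V : choiceType) (adj : rel V).
Hypothesis conn : graph_connected adj.

Lemma geodesic (x y : V) :
  exists p, [/\ path adj x p, last x p = y & size p = gdist adj x y].
Proof.
rewrite /gdist; case: pselect => [w|[]]; last exact: conn.
by case: ex_minnP => n /asboolP.
Qed.

Lemma gdist_le_size (x : V) (p : seq V) :
  path adj x p -> (gdist adj x (last x p) <= size p)%N.
Proof.
move=> px; rewrite /gdist; case: pselect => // w.
by case: ex_minnP => n _; apply; apply/asboolP; exists p.
Qed.

(** Cutting out the loops of [p] leaves a simple path with the same ends, which would be strictly
    shorter than the distance if a vertex were repeated. *)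
Lemma geodesic_uniq (x : V) (p : seq V) :
  path adj x p -> size p = gdist adj x (last x p) -> uniq (x :: p).
Proof.
move=> px; case: (shortenP px) => p' px' up' sub szp.
apply: (leq_size_uniq up') => [z|].
  by rewrite !inE => /predU1P[->|/sub ->]; rewrite ?eqxx ?orbT.
by rewrite /= ltnS szp gdist_le_size.
Qed.

Lemma gdistxx (x : V) : gdist adj x x = 0%N.
Proof. by apply/eqP; rewrite -leqn0; apply: (@gdist_le_size x [::]). Qed.

Lemma gdist_triangle (x y z : V) :
  (gdist adj x z <= gdist adj x y + gdist adj y z)%N.
Proof.
have [p [px ly <-]] := geodesic x y; have [r [ry lz <-]] := geodesic y z.
rewrite -size_cat -lz -ly -last_cat; apply: gdist_le_size.
by rewrite cat_path px ly.
Qed.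

Lemma gdist_adj (x y : V) : adj x y -> (gdist adj x y <= 1)%N.
Proof. by move=> xy; apply: (@gdist_le_size x [:: y]); rewrite /= xy. Qed.

Lemma finite_sphere (k : nat) (v : V) :
  (forall x, finite_set [set w | adj x w]) -> finite_set (sphere adj k v).
Proof.
move=> fin.
(* Ends of walks of length [k] form a larger set, but one that is built up one edge at a time and so
   suits induction. *)
suff: finite_set [set w | has_walk adj v w k].
  apply: sub_finite_set => w /= <-; apply/asboolP; exact: geodesic.
elim: k v => [|k IHk] v.
  apply: (sub_finite_set _ (finite_set1 v)) => w /asboolP[p [_ <-]].
  by move/size0nil->.
apply: (@sub_finite_set _ _ (\bigcup_(x in [set x | adj v x])
  [set w | has_walk adj x w k])).
  move=> w /asboolP[[|x p] []] //= /andP[vx px] lw [szp].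
  by exists x => //=; apply/asboolP; exists p.
by apply: bigcup_finite.
Qed.

End Distance.

(** * Unique geodesics, ancestors and descendants in a tree *)

Section Tree.
Variables (V : choiceType) (adj : rel V).
Hypothesis tree : is_tree adj.

Let adj_sym : symmetric adj. Proof. by case: tree. Qed.
Let adj_irr : irreflexive adj. Proof. by case: tree. Qed.
Let conn : graph_connected adj. Proof. by case: tree. Qed.

(* Where two simple paths with common ends first separate, the first segment up
   to their next meeting point closes with the reversed other one to a cycle. *)
Lemma simple_path_unique (x : V) (p r : seq V) :
  path adj x p -> path adj x r -> uniq (x :: p) -> uniq (x :: r) ->
  last x p = last x r -> p = r.
Proof.
elim: p x r => [|a p IHp] x [|b r] //.
- by move=> _ _ _ /= /andP[/negP xr _] lx; case: xr; rewrite {1}lx mem_last.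
- by move=> _ _ /= /andP[/negP xr _] _ lx; case: xr; rewrite -{1}lx mem_last.
have [<-{b}|neq_ab] := eqVneq a b.
  move=> /= /andP[_ pa] /andP[_ ra] /andP[_ ua] /andP[_ ub] lar.
  by rewrite (IHp a r).
move=> pp pr up ur lpr; exfalso.
have meet : has (mem (b :: r)) (a :: p).
  apply/hasP; exists (last a p); first exact: mem_last.
  by move: lpr => /= ->; apply: mem_last.
have [z [p1 [p2 [def_p zr p1r]]]] : exists z p1 p2,
    [/\ a :: p = rcons p1 z ++ p2, z \in b :: r & ~~ has (mem (b :: r)) p1].
  by case: (split_find meet) => z p1 p2 zr p1r; exists z, p1, p2.
have [r1 [r2 def_r]] : exists r1 r2, b :: r = r1 ++ z :: r2.
  by case: (splitPr zr) => r1 r2; exists r1, r2.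
have [_ _ _ acyc] := tree.
move: pp pr up ur p1r; rewrite def_p def_r.
rewrite cat_rcons !cat_path /= => /and3P[pp1 p1z _] /and3P[pr1 r1z _].
rewrite -cat_rcons -(cat_rcons z r1) mem_cat cat_uniq mem_cat cat_uniq.
rewrite !negb_or => /andP[/andP[xp1 _] /andP[up1 _]].
move=> /andP[/andP[xr1 _] /andP[ur1 _]] p1r.
have p1r1 : ~~ has (mem (rcons r1 z)) p1.
  apply: contra p1r => /hasP[t tp1 /= tr]; apply/hasP; exists t => //=.
  by rewrite mem_cat tr.
have : ucycle adj (x :: p1 ++ z :: rev r1).
  apply/andP; split.
    rewrite /= rcons_cat cat_path /= pp1 p1z /=.
    have := rev_path adj x (rcons r1 z).
    rewrite last_rcons belast_rcons rev_cons => ->.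
    rewrite (eq_path (e' := adj)) => [|u w]; last exact: adj_sym.
    by rewrite rcons_path pr1.
  rewrite /= mem_cat inE mem_rev negb_or.
  move: xp1 xr1 up1 ur1 p1r1; rewrite !mem_rcons !inE !rcons_uniq !negb_or.
  move=> /andP[-> ->] /andP[_ ->] /andP[zp1 up1] /andP[zr1 ur1] p1r1 /=.
  rewrite cat_uniq up1 /= mem_rev zr1 rev_uniq ur1 !andbT negb_or zp1 /=.
  apply: contra p1r1 => /hasP[t]; rewrite mem_rev /= => tr tp.
  by apply/hasP; exists t => //=; rewrite mem_rcons inE tr orbT.
(* The cycle has [size p1 + size r1 + 2] vertices, so acyclicity leaves only [p1] and [r1] empty;
   then [a] and [b] both equal [z]. *)
move/acyc; rewrite /= size_cat /= size_rev.
case: p1 def_p {pp1 p1z xp1 up1 p1r p1r1} => [|? ?] /=; last by rewrite addnS.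
case: r1 def_r {pr1 r1z xr1 ur1} => [|? ?] //= [bz _] [az _].
by rewrite az bz eqxx in neq_ab.
Qed.

Lemma size_simple_path (x : V) (p : seq V) :
  path adj x p -> uniq (x :: p) -> size p = gdist adj x (last x p).
Proof.
move=> px up; have [r [rx lr szr]] := geodesic conn x (last x p).
rewrite -szr; congr size; apply: (simple_path_unique px rx up) => //.
by apply: (geodesic_uniq rx); rewrite lr.
Qed.

(** The first two equations place [v] and [v'] on geodesics from [o] to [w]. These coincide, and
    equal depth means equal position on them. *)
Lemma ancestor_unique (o v v' w : V) :
  gdist adj o w = (gdist adj o v + gdist adj v w)%N ->
  gdist adj o w = (gdist adj o v' + gdist adj v' w)%N ->
  gdist adj o v = gdist adj o v' -> v = v'.
Proof.
have through u : gdist adj o w = (gdist adj o u + gdist adj u w)%N ->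
    exists p r, [/\ path adj o (p ++ r), uniq (o :: p ++ r),
      last o (p ++ r) = w, last o p = u & size p = gdist adj o u].
  move=> dw; have [p [po lp szp]] := geodesic conn o u.
  have [r [ru lr szr]] := geodesic conn u w; exists p, r.
  have por : path adj o (p ++ r) by rewrite cat_path po lp.
  have lpr : last o (p ++ r) = w by rewrite last_cat lp.
  split=> //; apply: (geodesic_uniq por).
  by rewrite size_cat lpr szp szr.
move=> /through[p [r [ppr upr lpr lp szp]]].
move=> /through[p' [r' [ppr' upr' lpr' lp' szp']]] dvv'.
have eq_pr : p ++ r = p' ++ r' by apply: (simple_path_unique (x := o)); rewrite ?lpr.
rewrite -lp -lp'; congr last.
by rewrite -(take_size_cat (s1 := p) r erefl) eq_pr take_size_cat // szp szp'.
Qed.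

(** A neighbour of [v] off the geodesic from [o] prolongs it to a simple path, hence to a geodesic.
    Only one neighbour can lie on it, so [a] or [b] is off it. *)
Lemma child_exists (o v a b : V) : adj v a -> adj v b -> a != b ->
  exists2 w, adj v w & gdist adj o w = (gdist adj o v).+1.
Proof.
move=> va vb neq_ab; have [p [po lp szp]] := geodesic conn o v.
have up : uniq (o :: p) by apply: (geodesic_uniq po); rewrite lp.
have outer w : adj v w -> w \notin o :: p ->
    exists2 w, adj v w & gdist adj o w = (gdist adj o v).+1.
  move=> vw wp; exists w => //.
  rewrite -szp -(size_rcons p w) -{1}(last_rcons o p w).
  rewrite -size_simple_path ?rcons_path ?po ?lp //.
  by rewrite -rcons_cons rcons_uniq wp.
have [/(outer _ va) //|/negPn ap] := boolP (a \notin o :: p).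
have [/(outer _ vb) //|/negPn bp] := boolP (b \notin o :: p).
(* The part of the geodesic from [w] to [v] and the single edge are both simple paths, hence equal:
   [w] is the vertex just before [v]. *)
have inner w : adj v w -> w \in o :: p -> w = last o (take (size p).-1 p).
  move=> vw wp; move: po lp up; clear -vw wp adj_sym adj_irr tree.
  case/splitPl: wp => p1 p2 lp1 po lp up.
  have -> : p2 = [:: v].
    move: po up; rewrite cat_path -cat_cons lp1 lastI cat_uniq => /andP[_ pw].
    rewrite lp1 => /and3P[up1 disj up2].
    apply: (simple_path_unique (x := w)) => //=.
    - by rewrite adj_sym vw.
    - rewrite up2 andbT; apply: contra disj => wp2; apply/hasP; exists w => //=.
      by rewrite mem_rcons mem_head.
    - by rewrite inE andbT; apply: contraTneq vw => ->; rewrite adj_irr.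
    - by rewrite -lp last_cat lp1.
  by rewrite cats1 size_rcons -cats1 take_size_cat.
by move: neq_ab; rewrite (inner a va ap) (inner b vb bp) eqxx.
Qed.

Lemma descendant_exists (o : V) (k : nat) (v : V) :
  (forall x, exists a b, [/\ adj x a, adj x b & a != b]) ->
  exists w, gdist adj v w = k /\ gdist adj o w = (gdist adj o v + k)%N.
Proof.
move=> branch; elim: k => [|k [u [dvu dou]]].
  by exists v; rewrite gdistxx addn0.
have [a [b [ua ub neq_ab]]] := branch u.
have [w uw dow] := child_exists o ua ub neq_ab.
exists w; rewrite dow dou addnS; split=> //; apply/eqP; rewrite eqn_leq.
(* The depth of [w] bounds its distance to [v] from below; the path through [u] bounds it from
   above. *)
have := gdist_triangle conn o v w; rewrite dow dou -addnS leq_add2l => ->.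
rewrite andbT (leq_trans (gdist_triangle conn v u w)) // dvu -addn1 leq_add2l.
exact: gdist_adj.
Qed.

End Tree.

(** * Dependence of spherical means on single values *)

Section MeanValue.
Variables (R : realType) (V : choiceType) (adj : rel V) (q : nat).
Hypothesis conn : graph_connected adj.
Implicit Types f : V -> R[i].

Definition sphere_weight (k : nat) : R[i] :=
  if k is j.+1 then ((q.+1 * q ^ j)%N%:R)^-1 else 1.

Lemma sphere_weight_neq0 (k : nat) : (0 < q)%N -> sphere_weight k != 0.
Proof.
move=> q_gt0; case: k => [|j]; rewrite /= ?GRing.oner_neq0 //.
by rewrite GRing.invr_eq0 Num.Theory.pnatr_eq0 -lt0n muln_gt0 expn_gt0 q_gt0.
Qed.

Lemma eq_mean_value (k : nat) f1 f2 (v : V) :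
  (forall w, gdist adj v w = k -> f1 w = f2 w) ->
  mean_value adj q k f1 v = mean_value adj q k f2 v.
Proof.
case: k => [|k] eqf /=; first by rewrite eqf // gdistxx.
by congr (_ * _); apply: eq_fsbigr => w; rewrite inE; apply: eqf.
Qed.

(** This isolates the diagonal term of the triangular system. Finiteness of the sphere allows the
    term at [u] to be split off the sum. *)
Lemma mean_valueB_single (k : nat) f1 f2 (v u : V) :
  (forall x, finite_set [set w | adj x w]) -> gdist adj v u = k ->
  (forall w, gdist adj v w = k -> w != u -> f1 w = f2 w) ->
  mean_value adj q k f1 v - mean_value adj q k f2 v =
  sphere_weight k * (f1 u - f2 u).
Proof.
move=> fin dvu eqf; case: k => [|k] /= in dvu eqf *.
  have [p [_ lp]] := geodesic conn v u; rewrite dvu => /size0nil p0.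
  by rewrite -lp p0 /= GRing.mul1r.
rewrite -GRing.mulrBr; congr (_ * _).
have finS : finite_set (sphere adj k.+1 v) by apply: finite_sphere.
rewrite (fsbigD1 u _ f1) // (fsbigD1 u _ f2) //= (eq_fsbigr f2) => [|w].
  by rewrite GRing.opprD GRing.addrACA GRing.subrr GRing.addr0.
by rewrite inE => -[dw /eqP]; apply: eqf.
Qed.

End MeanValue.

Lemma two_neighbors (V : choiceType) (adj : rel V) (q : nat) (x : V) :
  (1 <= q)%N -> ([set w | adj x w] #= `I_q.+1)%card ->
  exists a b, [/\ adj x a, adj x b & a != b].
Proof.
move=> q_gt0 /card_set_bijP[f [_ inj_f surj_f]].
have [a xa fa] := surj_f 0%N isT; have [b xb fb] := surj_f 1%N q_gt0.
by exists a, b; split=> //; apply: contra_eqN fb => /eqP <-; rewrite fa.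
Qed.

Theorem theorem2p2 (R : realType) (V : choiceType) (adj : rel V) (q : nat)
    (hq : (1 <= q)%N) (hX : homogeneous_tree adj q)
    (k : nat) (c : nat -> R[i]) (hck : c k != 0) :
  set_surj [set: V -> R[i]] [set: V -> R[i]] (mean_value_comb adj q k c).
Proof.
move=> g _; have [tree deg] := hX; have [_ _ conn _] := tree.
have fin x : finite_set [set w | adj x w] by exists q.+1.
(* On an empty vertex set there is no root, but all functions agree and [g] is its own preimage. *)
have [[o _]|noV] := pselect (exists o : V, True); last first.
  by exists g => //; apply/funext => v; case: noV; exists v.
have /choice[s s_desc] : forall v, exists w,
    gdist adj v w = k /\ gdist adj o w = (gdist adj o v + k)%N.
  by move=> v; apply: descendant_exists => // x; apply: two_neighbors (deg x).
have s_dist v : gdist adj v (s v) = k by case: (s_desc v).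
have s_depth v : gdist adj o (s v) = (gdist adj o v + k)%N by case: (s_desc v).
have ancestor_s v v' : gdist adj v (s v') = k ->
    gdist adj o v = gdist adj o v' -> v = v'.
  move=> dv dvv'; apply: (ancestor_unique tree (o := o) (w := s v')) => //.
  - by rewrite s_depth dv dvv'.
  - by rewrite s_depth s_dist.
have s_inj v v' : s v = s v' -> v = v'.
  move=> ss; apply: ancestor_s; first by rewrite -ss.
  by have /eqP := s_depth v; rewrite ss s_depth eqn_add2r => /eqP.
(* Transport of [h] along [s], extended by 0 off its image; by injectivity of [s] the chosen
   preimage is the only one. *)
pose ext (h : V -> R[i]) (u : V) : R[i] :=
  if pselect (exists v, s v = u) is left e then h (sval (cid e)) else 0.
have extE h v : ext h (s v) = h v.
  rewrite /ext; case: pselect => [e|[]]; last by exists v.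
  by congr h; apply: s_inj; rewrite (svalP (cid e)).
have eq_ext h1 h2 u : (forall v, s v = u -> h1 v = h2 v) -> ext h1 u = ext h2 u.
  move=> eqh; rewrite /ext; case: pselect => // e.
  by apply: eqh; rewrite (svalP (cid e)).
pose a := c k * sphere_weight R q k.
have a_neq0 : a != 0 by rewrite GRing.mulf_neq0 ?sphere_weight_neq0.
(* One step of solving the equation at [v] for the diagonal unknown: [h v] cancels against its own
   contribution [a * h v], and the fixed points are the solutions. *)
pose Phi h v := h v + (g v - mean_value_comb adj q k c (ext h) v) / a.
have [|h h_fix] := @triangular_fixpoint V R[i] (gdist adj o) Phi (fun=> 0).
  move=> h1 h2 v eqh.
  have depth_le i v' : gdist adj v (s v') = i ->
      (gdist adj o v' + k <= gdist adj o v + i)%N.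
    by move=> <-; rewrite -s_depth gdist_triangle.
  (* Radii below [k] only reach unknowns of depth less than that of [v], where [h1] and [h2] agree;
     radius [k] adds the unknown at [v] alone. *)
  have diff : mean_value_comb adj q k c (ext h1) v
      - mean_value_comb adj q k c (ext h2) v = a * (h1 v - h2 v).
    rewrite /mean_value_comb !big_ord_recr /=.
    rewrite (eq_bigr (fun i : 'I_k => c i * mean_value adj q i (ext h2) v)).
      rewrite GRing.opprD GRing.addrACA GRing.subrr GRing.add0r -GRing.mulrBr.
      rewrite (mean_valueB_single q conn fin (s_dist v)) ?extE ?GRing.mulrA //.
      move=> w dw neq; apply: eq_ext => v' sv'; apply: eqh; rewrite -sv' in dw neq.
      have := depth_le _ _ dw; rewrite leq_add2r leq_eqVlt => /predU1P[eqd|//].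
      by rewrite (ancestor_s v v') ?eqxx in neq.
    move=> i _; congr (_ * _); apply: eq_mean_value => // w dw.
    apply: eq_ext => v' sv'; apply: eqh; rewrite -sv' in dw.
    rewrite -(ltn_add2r k) (leq_ltn_trans (depth_le _ _ dw)) //.
    by rewrite ltn_add2l.
  by rewrite /Phi -(GRing.subrK (mean_value_comb adj q k c (ext h2) v)
    (mean_value_comb adj q k c (ext h1) v)) diff; field.
exists (ext h) => //; apply/funext => v.
have /eqP := h_fix v; rewrite /Phi eq_sym -GRing.subr_eq0 GRing.addrAC GRing.subrr.
rewrite GRing.add0r GRing.mulf_eq0 GRing.invr_eq0 (negPf a_neq0) orbF.
by rewrite GRing.subr_eq0 => /eqP.
Qed.
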